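(* Let $\mathcal{S}=\{1,\dots,S\}$, let $\mathcal{Y}^s\subseteq\mathbb{R}^p$, $s\in\mathcal{S}$, be finite non-empty sets, and let $\mathcal{Y}=\bigoplus_{s\in\mathcal{S}}\mathcal{Y}^s$. For any generator set $\mathcal{G}=\{\mathcal{G}^1,\dots,\mathcal{G}^S\}$, $\mathcal{Y}^s_{\mathrm{se}}\subseteq\mathcal{G}^s$ for all $s\in\mathcal{S}$.
   Context: For sets $A^s\subseteq\mathbb{R}^p$, $\bigoplus_s A^s=\{\sum_s a^s\mid a^s\in A^s\}$ is the Minkowski sum. For $u,v\in\mathbb{R}^p$: $u\leqq v$ means $u_i\le v_i$ for all $i$; $u\leq v$ means $u\leqq v$ and $u\ne v$. For $A\subseteq\mathbb{R}^p$, $A_{\mathrm N}=\{a\in A\mid\nexists a'\in A:a'\leq a\}$ is the nondominated set; $A$ is stable if $A=A_{\mathrm N}$. With $\mathbb{R}^p_{>}$ the set of vectors with all components strictly positive and $A_\lambda=\arg\min\{\lambda^{\mathrm T}a\mid a\in A\}$ the set of minimizers, the set of (supported) extreme nondominated vectors of $A$ is $A_{\mathrm{se}}=\{a\in A\mid\exists\lambda\in\mathbb{R}^p_{>}:a\in A_\lambda,\ |A_\lambda|=1\}$; for $A=\mathcal{Y}^s$ it is denoted $\mathcal{Y}^s_{\mathrm{se}}$. A generator set is a family $\mathcal{G}=\{\mathcal{G}^1,\dots,\mathcal{G}^S\}$ (indexed by $\mathcal{S}$) of stable sets $\mathcal{G}^s\subseteq\mathcal{Y}^s$ with $\mathcal{Y}_{\mathrm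 N}=(\bigoplus_{s\in\mathcal{S}}\mathcal{G}^s)_{\mathrm N}$. *)

(* Defs.v *)
From HB Require Import structures.
From mathcomp Require Import all_boot all_order all_algebra.
From mathcomp Require Import classical_sets cardinality reals.
Set Implicit Arguments.
Unset Strict Implicit.
Unset Printing Implicit Defensive.
Import Order.TTheory GRing.Theory Num.Theory.
Local Open Scope classical_set_scope.
Local Open Scope ring_scope.

Definition vleqq (R : realType) (p : nat) (u v : 'cV[R]_p) : Prop :=
  forall i, u i 0 <= v i 0.

Definition vleq (R : realType) (p : nat) (u v : 'cV[R]_p) : Prop :=
  vleqq u v /\ u <> v.

Definition minkowski_sum (R : realType) (p k : nat)
    (A : 'I_k -> set 'cV[R]_p) : set 'cV[R]_p :=
  [set \sum_(s < k) a s | a in [set a : 'I_k -> 'cV[R]_p | forall s, A s (a s)]].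

Definition nondominated (R : realType) (p : nat) (A : set 'cV[R]_p) :
    set 'cV[R]_p :=
  [set a | A a /\ ~ exists2 a', A a' & vleq a' a].

Definition stable (R : realType) (p : nat) (A : set 'cV[R]_p) : Prop :=
  A = nondominated A.

Definition weighted_argmin (R : realType) (p : nat) (lambda : 'cV[R]_p)
    (A : set 'cV[R]_p) : set 'cV[R]_p :=
  [set a | A a /\
    forall b, A b -> (lambda^T *m a) 0 0 <= (lambda^T *m b) 0 0].

(* |A_lambda| = 1 is equipotence with `I_1 = {0}. *)
Definition extreme_supported (R : realType) (p : nat) (A : set 'cV[R]_p) :
    set 'cV[R]_p :=
  [set a | A a /\ exists lambda : 'cV[R]_p,
    [/\ forall i, 0 < lambda i 0,
        weighted_argmin lambda A a &
        (weighted_argmin lambda A #= `I_1)%card]].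

Definition generator_set (R : realType) (p k : nat)
    (Y G : 'I_k -> set 'cV[R]_p) : Prop :=
  [/\ forall s, stable (G s),
      forall s, G s `<=` Y s &
      nondominated (minkowski_sum Y) = nondominated (minkowski_sum G)].

(* Main.v *)
Require Import Defs.
From HB Require Import structures.
From mathcomp Require Import all_boot all_order all_algebra.
From mathcomp Require Import boolp classical_sets cardinality reals.
Set Implicit Arguments.
Unset Strict Implicit.
Unset Printing Implicit Defensive.
Import Order.TTheory GRing.Theory Num.Theory.
Local Open Scope classical_set_scope.
Local Open Scope ring_scope.

(** A vector [y] that is the unique minimizer over [Y s] of some strictly
    positive functional [lambda] is forced into [G s] by the following
    argument. Complete [y] by arbitrary [lambda]-minimizers of the other [Y t],
    which exist by finiteness ([finite_set_argmin]). Minimization of a linear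
    functional over a Minkowski sum splits over the summands, so the resulting
    sum minimizes [lambda] over the sum of the [Y t]
    ([weighted_argmin_minkowski_sum]) and is nondominated there
    ([weighted_argmin_nondominated]). By the generator property it is also a sum
    of some [g t] in [G t], each of which lies in [Y t]. Conversely, a minimizer
    of the Minkowski sum can only be written with summands that are all
    minimizers ([weighted_argmin_summand]), so [g s] minimizes [lambda] over
    [Y s], and [g s = y] by uniqueness. *)

Lemma weight_sum (R : realType) (p k : nat) (lambda : 'cV[R]_p)
    (a : 'I_k -> 'cV[R]_p) :
  (lambda^T *m \sum_s a s) 0 0 = \sum_s (lambda^T *m a s) 0 0.
Proof. by rewrite mulmx_sumr summxE. Qed.

(** Strict positivity of every weight makes the weighted sum notice a strict
    decrease in any single component. *)
Lemma weight_vleq (R : realType) (p : nat) (lambda u v : 'cV[R]_p) :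
  (forall i, 0 < lambda i 0) -> vleq u v ->
  (lambda^T *m u) 0 0 < (lambda^T *m v) 0 0.
Proof.
move=> lambda_gt0 [le_uv neq_uv]; rewrite lt_neqAle; apply/andP; split.
- apply/eqP => eq_w; apply: neq_uv; apply/colP => i; apply/eqP.
  have sum0 : \sum_j lambda j 0 * (v j 0 - u j 0) = 0.
    transitivity ((lambda^T *m v) 0 0 - (lambda^T *m u) 0 0).
      rewrite !mxE -sumrB; apply: eq_bigr => j _.
      by rewrite !mxE mulrBr.
    by rewrite eq_w subrr.
  have term_ge0 j : true -> 0 <= lambda j 0 * (v j 0 - u j 0).
    by move=> _; rewrite mulr_ge0 ?subr_ge0 // ltW.
  have term0 : lambda i 0 * (v i 0 - u i 0) = 0 := psumr_eq0P term_ge0 sum0 isT.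
  by move/eqP: term0; rewrite mulf_eq0 gt_eqF //= subr_eq0 eq_sym.
- rewrite !mxE; apply: ler_sum => j _.
  by rewrite !mxE ler_wpM2l // ltW.
Qed.

Lemma weighted_argmin_nondominated (R : realType) (p : nat)
    (lambda : 'cV[R]_p) (A : set 'cV[R]_p) :
  (forall i, 0 < lambda i 0) ->
  weighted_argmin lambda A `<=` nondominated A.
Proof.
move=> lambda_gt0 a [Aa min_a]; split=> // -[b Ab /(weight_vleq lambda_gt0)].
by rewrite ltNge min_a.
Qed.

Lemma finite_set_argmin (R : realType) (p : nat) (lambda : 'cV[R]_p)
    (A : set 'cV[R]_p) :
  finite_set A -> A !=set0 -> weighted_argmin lambda A !=set0.
Proof.
move=> /finite_seqP[r ->{A}] [x0 /= x0r].
elim: r x0 x0r => [//|x r IHr] _ _.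
case: r IHr => [_|y r IHr].
  by exists x; split; rewrite /= ?mem_head // => b; rewrite /= inE => /eqP->.
have [m [/= mr min_m]] := IHr y (mem_head y r).
have [le_xm|lt_mx] :=
    leP ((lambda^T *m x) 0 0) ((lambda^T *m m) 0 0).
- exists x; split=> /= [|b]; first exact: mem_head.
  rewrite inE => /predU1P[->//|/min_m]; exact: le_trans.
- exists m; split=> /= [|b]; first by rewrite inE mr orbT.
  by rewrite inE => /predU1P[->|/min_m //]; exact: ltW.
Qed.

Lemma weighted_argmin_minkowski_sum (R : realType) (p k : nat)
    (lambda : 'cV[R]_p) (A : 'I_k -> set 'cV[R]_p) (a : 'I_k -> 'cV[R]_p) :
  (forall s, weighted_argmin lambda (A s) (a s)) ->
  weighted_argmin lambda (minkowski_sum A) (\sum_s a s).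
Proof.
move=> min_a; split; first by exists a => // s; case: (min_a s).
move=> _ [b Ab <-]; rewrite !weight_sum; apply: ler_sum => s _.
by case: (min_a s) => _; apply; exact: Ab.
Qed.

(** If one summand could be improved within its own set, exchanging it alone
    would improve the whole sum. *)
Lemma weighted_argmin_summand (R : realType) (p k : nat)
    (lambda : 'cV[R]_p) (A : 'I_k -> set 'cV[R]_p) (a : 'I_k -> 'cV[R]_p) :
  (forall s, A s (a s)) ->
  weighted_argmin lambda (minkowski_sum A) (\sum_s a s) ->
  forall s, weighted_argmin lambda (A s) (a s).
Proof.
move=> Aa [_ min_a] s; split=> [|b Ab]; first exact: Aa.
pose c t := if t == s then b else a t.
have /min_a : minkowski_sum A (\sum_t c t).
  by exists c => // t; rewrite /c; case: eqP => [->|].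
rewrite !weight_sum (bigD1 s) //= [leRHS](bigD1 s) //= {1}/c eqxx.
rewrite [X in _ <= _ + X](eq_bigr (fun t => (lambda^T *m a t) 0 0)).
  by rewrite lerD2r.
by move=> t /negPf nts; rewrite /c nts.
Qed.

Lemma card_eq_I1_unique (T : Type) (A : set T) (x y : T) :
  (A #= `I_1)%card -> A x -> A y -> x = y.
Proof.
rewrite card_eq_le => /andP[/pcard_leP/injfunPex[f fun_f inj_f] _] Ax Ay.
apply: inj_f; rewrite ?inE //.
by have := fun_f _ Ax; have := fun_f _ Ay; rewrite II1 => -> ->.
Qed.

Theorem corollary3p2 (R : realType) (p k : nat)
    (Y : 'I_k -> set 'cV[R]_p)
    (hfin : forall s, finite_set (Y s))
    (hne : forall s, Y s !=set0)
    (G : 'I_k -> set 'cV[R]_p)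
    (hG : generator_set Y G) :
  forall s, extreme_supported (Y s) `<=` G s.
Proof.
move=> s y [_ [lambda [lambda_gt0 min_y card_argmin]]].
case: hG => _ subGY eqN.
have /choice[m min_m] t :
    exists x, weighted_argmin lambda (Y t) x /\ (t = s -> x = y).
  have [->|nts] := eqVneq t s; first by exists y.
  have [x min_x] := finite_set_argmin lambda (hfin t) (hne t).
  by exists x; split=> // /eqP; rewrite (negPf nts).
have min_sum : weighted_argmin lambda (minkowski_sum Y) (\sum_t m t).
  by apply: weighted_argmin_minkowski_sum => t; case: (min_m t).
have := weighted_argmin_nondominated lambda_gt0 min_sum.
rewrite eqN => -[[g Gg sum_g] _].
rewrite -sum_g in min_sum.
have min_g := weighted_argmin_summand (fun t => subGY t _ (Gg t)) min_sum s.
by rewrite (card_eq_I1_unique card_argmin min_y min_g); exact: Gg.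
Qed.
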